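(* Let $q$ be odd, $\varepsilon=\left(\frac{-1}{q}\right)$, $\nu=\left(\frac2q\right)$, $m=(q-\varepsilon)/4$. In ${\mathbb F}_q[x]$: (i) $T_m(x)=2^{m-1}\prod\{x-b: b\in\mathcal B_1^{-\nu,-\nu}\}$ and $U_{m-1}(x)=2^{m-1}\prod\{x-b:b\in\mathcal B_1^{\nu,\nu}\}$. (ii) $U_{(q-3)/2}(x)=2^{(q-3)/2}\prod\{x-b: b\in{\mathbb F}_q,\ \left(\frac{b^2-1}{q}\right)=1\}$ and $U_{(q-1)/2}(x)=2^{(q-1)/2}\prod\{x-b: b\in{\mathbb F}_q,\ \left(\frac{b^2-1}{q}\right)=-1\}$.
   Context: Chebyshev polynomials $T_k,U_k\in\mathbb Z[x]$: $T_0=1$, $T_1=x$, $T_{k+2}=2xT_{k+1}-T_k$; $U_0=1$, $U_1=2x$, $U_{k+2}=2xU_{k+1}-U_k$. $\left(\frac{a}{q}\right)$ is the Legendre symbol on ${\mathbb F}_q$. For $\lambda\in{\mathbb F}_q^\times$, $\varepsilon_1,\varepsilon_2\in\{\pm1\}$, $\mathcal B_\lambda^{\varepsilon_1,\varepsilon_2}=\{b\in{\mathbb F}_q:\left(\frac{\lambda-b}{q}\right)=\varepsilon_1,\ \left(\frac{\lambda+b}{q}\right)=\varepsilon_2\}$. Empty products equal $1$. *)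

(* Defs.v *)
From HB Require Import structures.
From mathcomp Require Import all_boot all_order all_algebra all_field.
Set Implicit Arguments. Unset Strict Implicit. Unset Printing Implicit Defensive.
Import Order.TTheory GRing.Theory Num.Theory.
Local Open Scope ring_scope.

(* Chebyshev polynomials, defined by the integer recursion (so over any ring
   R they are the images of the integral Chebyshev polynomials). *)
Fixpoint chebT (R : nzRingType) (n : nat) : {poly R} :=
  match n with
  | 0%N => 1
  | m.+1 => match m with
            | 0%N => 'X
            | k.+1 => 'X *+ 2 * chebT R m - chebT R k
            end
  end.

Fixpoint chebU (R : nzRingType) (n : nat) : {poly R} :=
  match n with
  | 0%N => 1
  | m.+1 => match m with
            | 0%N => 'X *+ 2
            | k.+1 => 'X *+ 2 * chebU R m - chebU R k
            end
  end.

Definition legendre (F : finFieldType) (a : F) : int :=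
  if a == 0 then 0 else if [exists x : F, x ^+ 2 == a] then 1 else -1.

Definition Bset (F : finFieldType) (lam : F) (e1 e2 : int) : {set F} :=
  [set b : F | (legendre (lam - b) == e1) && (legendre (lam + b) == e2)].

(* Main.v *)
(** For b in F with b ^ 2 <> 1 write 2 b = z + 1 / z with z in an extension of
    F, so that 2 T_k(b) = z ^ k + z ^ -k and (z - 1 / z) U_(k-1)(b) =
    z ^ k - z ^ -k.  By Frobenius, z ^ q is z or 1 / z according to the Legendre
    symbol of b ^ 2 - 1; moreover (z + 1) ^ 2 = 2 z (b + 1) gives the value +-1
    of z ^ (2 m) when 1 - b and 1 + b have the same nonzero symbol.  So every b
    in the four sets is a root of the polynomial attached to it, and within each
    part the degrees add up to the number of elements of the two sets. *)

Require Import Defs.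
From HB Require Import structures.
From mathcomp Require Import all_boot all_order all_algebra all_fingroup.
From mathcomp Require Import all_solvable all_field.
From mathcomp Require Import ring zify.
Import Order.TTheory GRing.Theory Num.Theory.
Local Open Scope ring_scope.

Set Implicit Arguments.
Unset Strict Implicit.
Unset Printing Implicit Defensive.

(** * Coefficients and degrees *)

(** The recursion reaches back two indices, so strong induction carries all four claims together.
    The ring may have 2 = 0, hence coefficients rather than sizes. *)
Lemma cheb_coef (R : comNzRingType) (n : nat) :
  [/\ (forall i, (n < i)%N -> (chebT R n)`_i = 0),
      (chebT R n)`_n = 2 ^+ n.-1,
      (forall i, (n < i)%N -> (chebU R n)`_i = 0)
    & (chebU R n)`_n = 2 ^+ n].
Proof.
elim/ltn_ind: n => -[_|[_|n IH]].
- by split=> [i||i|] /=; rewrite ?coefC ?expr0 //; case: i.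
- split=> [i||i|] /=; rewrite ?coefMn ?coefX ?expr0 ?expr1 //.
    by case: i => [|[]].
  by case: i => [|[]] //= i _; rewrite mul0rn.
have [T1 t1 U1 u1] := IH n.+1 (ltnSn _).
have [T0 t0 U0 u0] := IH n (ltnW (ltnSn _)).
have coefXM2 (P : {poly R}) i : ('X *+ 2 * P)`_i.+1 = 2 * P`_i.
  by rewrite [RHS]mulr_natl mulrnAl coefMn coefXM.
split=> [[|i] // ni||[|i] // ni|];
  rewrite /= -/(chebT R n.+1) -/(chebU R n.+1) coefB coefXM2.
- by rewrite T1 // T0 ?mulr0 ?subr0 //; lia.
- by rewrite t1 T0 ?subr0 -?exprS //; lia.
- by rewrite U1 // U0 ?mulr0 ?subr0 //; lia.
- by rewrite u1 U0 ?subr0 -?exprS //; lia.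
Qed.

Lemma size_lead_poly (R : nzRingType) (p : {poly R}) (n : nat) (c : R) :
  (forall i, (n < i)%N -> p`_i = 0) -> p`_n = c -> c != 0 ->
  size p = n.+1 /\ lead_coef p = c.
Proof.
move=> p_gt <- pn; have sz : size p = n.+1.
  apply/eqP; rewrite eqn_leq; apply/andP; split; first exact/leq_sizeP.
  by rewrite ltnNge; apply: contra pn => /leq_sizeP->.
by rewrite lead_coefE sz.
Qed.

Lemma size_lead_chebT (F : fieldType) (n : nat) : (2 : F) != 0 ->
  size (chebT F n) = n.+1 /\ lead_coef (chebT F n) = 2 ^+ n.-1.
Proof.
move=> two; have [? ? _ _] := cheb_coef F n.
by apply: size_lead_poly; rewrite ?expf_neq0.
Qed.

Lemma size_lead_chebU (F : fieldType) (n : nat) : (2 : F) != 0 ->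
  size (chebU F n) = n.+1 /\ lead_coef (chebU F n) = 2 ^+ n.
Proof.
move=> two; have [_ _ ? ?] := cheb_coef F n.
by apply: size_lead_poly; rewrite ?expf_neq0.
Qed.

(** * Values at (z + 1/z)/2 *)

(** Both sides satisfy u_(k+2) = (z + z') u_(k+1) - u_k with the same first two terms; [z'] stands
    for 1/z. *)
Lemma chebT_Joukowski (R L : comNzRingType) (f : {rmorphism R -> L}) (b : R)
    (z z' : L) (n : nat) :
  z * z' = 1 -> z + z' = 2 * f b ->
  2 * f (chebT R n).[b] = z ^+ n + z' ^+ n.
Proof.
move=> zz' sz; elim/ltn_ind: n => -[_|[_|n IH]].
- by rewrite /= hornerE rmorph1 !expr0 mulr1.
- by rewrite /= hornerE !expr1.
have -> : f (chebT R n.+2).[b] =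
    (z + z') * f (chebT R n.+1).[b] - f (chebT R n).[b].
  rewrite sz /= hornerD hornerN hornerM hornerMn hornerX.
  by rewrite rmorphB rmorphM rmorphMn mulr_natl.
rewrite mulrBr mulrCA !IH // !exprS; ring: zz'.
Qed.

Lemma chebU_Joukowski (R L : comNzRingType) (f : {rmorphism R -> L}) (b : R)
    (z z' : L) (n : nat) :
  z * z' = 1 -> z + z' = 2 * f b ->
  (z - z') * f (chebU R n).[b] = z ^+ n.+1 - z' ^+ n.+1.
Proof.
move=> zz' sz; elim/ltn_ind: n => -[_|[_|n IH]].
- by rewrite /= hornerE rmorph1 !expr1 mulr1.
- by rewrite /= hornerMn hornerX rmorphMn -mulr_natl -sz; ring.
have -> : f (chebU R n.+2).[b] =
    (z + z') * f (chebU R n.+1).[b] - f (chebU R n).[b].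
  rewrite sz /= hornerD hornerN hornerM hornerMn hornerX.
  by rewrite rmorphB rmorphM rmorphMn mulr_natl.
rewrite mulrBr mulrCA !IH // !exprS; ring: zz'.
Qed.

(** * Factorization by counting roots *)

(* Each product has at most as many factors as the degree allows, so the bound
   on the total number of factors forces equality in both. *)
Lemma prod_complementary_roots (F : finFieldType) (P Q : {poly F})
    (A B : {set F}) :
  P != 0 -> Q != 0 ->
  {in A, forall b, root P b} -> {in B, forall b, root Q b} ->
  (size P + size Q <= #|A| + #|B| + 2)%N ->
  [/\ size P = #|A|.+1, size Q = #|B|.+1,
      P = (lead_coef P)%:P * \prod_(b in A) ('X - b%:P)
    & Q = (lead_coef Q)%:P * \prod_(b in B) ('X - b%:P)].
Proof.
have rootsE (S : {set F}) (p : {poly F}) : {in S, forall b, root p b} ->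
    size p = #|S|.+1 -> p = (lead_coef p)%:P * \prod_(b in S) ('X - b%:P).
  move=> rt sz; rewrite {1}(@all_roots_prod_XsubC _ p (enum S)).
  - by rewrite big_enum mul_polyC.
  - by rewrite -cardE.
  - by apply/allP=> b; rewrite mem_enum; apply: rt.
  - by rewrite uniq_rootsE enum_uniq.
have bound (S : {set F}) (p : {poly F}) :
    p != 0 -> {in S, forall b, root p b} ->
    (#|S| < size p)%N.
  move=> p0 rt; rewrite cardE; apply: max_poly_roots; rewrite ?enum_uniq //.
  by apply/allP=> b; rewrite mem_enum; apply: rt.
move=> P0 Q0 rA rB; have := bound _ _ P0 rA; have := bound _ _ Q0 rB.
by move=> ? ? ?; split; do ?[apply: rootsE => //]; lia.
Qed.

(** * Odd finite fields and Euler's criterion *)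

Lemma card_finField_pnat (F : finFieldType) :
  exists2 p, p \in [pchar F] & p.-nat #|F|.
Proof.
have [p p_pr pF] := finPcharP F; exists p => //.
by rewrite -cardsT; apply: abelem_pgroup (fin_ring_pchar_abelem pF).
Qed.

Section OddFiniteField.

Variable F : finFieldType.
Hypothesis hodd : odd #|F|.

(** As q = 2n + 1, this is Euler's exponent (q - 1)/2; [uphalf n] will turn out to be the m of the
    theorem. *)
Let n := #|F|./2.

Lemma card_odd : #|F| = n.*2.+1.
Proof. by rewrite -[LHS]odd_double_half hodd. Qed.

Lemma half_card_gt0 : (0 < n)%N.
Proof. by have := finNzRing_gt1 F; rewrite card_odd; case: n. Qed.

Lemma expf_card_pred (a : F) : a != 0 -> a ^+ n.*2 = 1.
Proof.
by move=> a0; apply: (mulfI a0); rewrite -exprS -card_odd expf_card mulr1.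
Qed.

Lemma two_neq0 : (2 : F) != 0.
Proof.
have [p pF p_nat] := card_finField_pnat F.
(* If 2 = 0, the characteristic is 2 and q > 1 is a power of 2, hence even. *)
have p_pr := pcharf_prime pF; apply: contraL hodd => /eqP two0.
have : (p %| 2)%N by rewrite (dvdn_pcharf pF) two0.
rewrite dvdn_prime2 // => /eqP p2; move: p_nat; rewrite p2 => /p_natP[e cardF].
have := finNzRing_gt1 F; rewrite cardF.
by case: e {cardF} => // e; rewrite oddX.
Qed.

Lemma two_neq0_extension (L : fieldType) (f : {rmorphism F -> L}) :
  (2 : L) != 0.
Proof. by rewrite -(rmorph_nat f) fmorph_eq0 two_neq0. Qed.

Lemma one_neqN1 : (1 : F) != -1.
Proof. by rewrite -subr_eq0 opprK two_neq0. Qed.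

Lemma legendre_Euler (a : F) : (legendre a)%:~R = a ^+ n.
Proof.
rewrite /legendre; case: eqVneq => [->|a0].
  by rewrite expr0n -leqn0 leqNgt half_card_gt0.
have an : a ^+ n = 1 \/ a ^+ n = -1.
  apply/pred2P; rewrite -eqf_sqr expr1n -exprM muln2; exact/eqP/expf_card_pred.
case: existsP => [[x /eqP xa]|nsq].
  have x0 : x != 0 by apply: contraNneq a0 => x0; rewrite -xa x0 expr0n.
  by rewrite -xa -exprM mul2n expf_card_pred.
case: an => [an|->] //; case: nsq.
(* A nonsquare with a^n = 1 is impossible: a = g^i for a generator g, and 2n | i n makes i even. *)
have /hasP[g _ pg] : has n.*2.-primitive_root (enum [pred x : F | x != 0]).
  apply: has_prim_root; rewrite ?enum_uniq //.
  - by rewrite double_gt0 half_card_gt0.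
  - apply/allP => x; rewrite mem_enum inE unity_rootE => x0.
    by rewrite expf_card_pred.
  - rewrite -cardE; have := cardC1 (0 : F); rewrite card_odd /= => <-.
    by apply/eq_leq/eq_card.
have [i ai] := prim_rootP pg (expf_card_pred a0).
have : (2 * n %| i * n)%N by rewrite mul2n (prim_order_dvd pg) exprM -ai an.
rewrite dvdn_pmul2r ?half_card_gt0 // => /dvdnP[j ij].
by exists (g ^+ j); rewrite -exprM -ij ai.
Qed.

Lemma legendre_neq0 (a : F) : a != 0 -> legendre a = 1 \/ legendre a = -1.
Proof. by rewrite /legendre => /negPf->; case: ifP; [left | right]. Qed.

(** 0, 1 and -1 stay distinct in F, so the integer symbol is determined by its image there. *)
Lemma legendre_eq (a : F) (s : int) : s = 1 \/ s = -1 ->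
  (legendre a == s) = (a ^+ n == s%:~R).
Proof.
move=> hs; rewrite -legendre_Euler; apply/eqP/eqP => [-> //|].
have [->|/legendre_neq0[]->] := eqVneq a 0; case: hs => ->;
  rewrite ?rmorphN ?rmorph1 //= ?[legendre 0]/legendre ?eqxx => /eqP;
  by rewrite ?[_ == 1]eq_sym ?[0 == - 1]eq_sym ?oppr_eq0
    ?(negPf one_neqN1) ?oner_eq0.
Qed.

(** * Frobenius on the solutions of z + 1/z = 2b *)

(** Take z = b + y and 1/z = b - y with y^2 = b^2 - 1. By Euler y^q = y (y^2)^n is y or -y, so
    Frobenius fixes z or swaps it with 1/z. Additivity of the q-th power is exported to compute (z +
    1)^q later. *)
Lemma joukowski_preimage (b : F) : b ^+ 2 - 1 != 0 ->
  exists (L : fieldType) (f : {rmorphism F -> L}) (z z' : L),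
    [/\ z * z' = 1, z + z' = 2 * f b, z != z',
        (forall x y : L, (x + y) ^+ #|F| = x ^+ #|F| + y ^+ #|F|)
      & z ^+ #|F| = (if legendre (b ^+ 2 - 1) == 1 then z else z')].
Proof.
move=> d0; have [L [f _]] := countable_algebraic_closure F.
have [y y2] : exists y : L, y ^+ 2 = f (b ^+ 2 - 1).
  (* The coefficient function encodes y^2 = f (b^2 - 1) + 0 y. *)
  have [y yE] := @solve_monicpoly L 2%N
    (fun i => if i is 0%N then f (b ^+ 2 - 1) else 0) isT.
  exists y; apply: (etrans yE).
  by rewrite !big_ord_recl big_ord0 /= expr0 mulr1 mul0r !addr0.
have Frob (u v : L) : (u + v) ^+ #|F| = u ^+ #|F| + v ^+ #|F|.
  have [p pF p_nat] := card_finField_pnat F.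
  apply: exprDn_pchar.
  by rewrite (eq_pnat _ (pcharf_eq (rmorph_pchar f pF))).
have y0 : y != 0.
  apply: contraNneq d0 => y0; move/eqP: y2.
  by rewrite y0 expr0n eq_sym fmorph_eq0.
have two0 := two_neq0_extension f.
exists L, f, (f b + y), (f b - y); split=> //.
- by rewrite mulrC -subr_sqr y2 rmorphB rmorphXn rmorph1 subKr.
- ring.
- by rewrite -subr_eq0 (_ : _ - _ = 2 * y) ?mulf_neq0 //; ring.
rewrite Frob -rmorphXn expf_card card_odd.
rewrite exprS -mul2n exprM y2 -rmorphXn -legendre_Euler.
have [->|->] := legendre_neq0 d0;
  rewrite /= ?rmorphN rmorph1 ?rmorphN ?rmorph1; ring.
Qed.

Lemma expr_inverse_pair (L : comNzRingType) (z z' : L) (k : nat) :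
  z * z' = 1 -> z ^+ k = z ^+ k.*2 * z' ^+ k.
Proof. by move=> zz'; rewrite -addnn exprD -mulrA -exprMn zz' expr1n mulr1. Qed.

(** * Roots of the Chebyshev polynomials *)

(** The hypothesis on z says z^(k+1) = z'^(k+1); then the nonzero factor z - z' cancels in
    [chebU_Joukowski]. *)
Lemma root_chebU (L : fieldType) (f : {rmorphism F -> L}) (b : F) (z z' : L) k :
  z * z' = 1 -> z + z' = 2 * f b -> z != z' -> z ^+ k.+1.*2 = 1 ->
  root (chebU F k) b.
Proof.
move=> zz' sz zNz' zk; rewrite rootE -(fmorph_eq0 f).
have := chebU_Joukowski k zz' sz.
rewrite (expr_inverse_pair k.+1 zz') zk mul1r subrr => /eqP.
by rewrite mulf_eq0 subr_eq0 (negPf zNz').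
Qed.

(** Here z^k = -z'^k, so the sum in [chebT_Joukowski] vanishes. *)
Lemma root_chebT (L : fieldType) (f : {rmorphism F -> L}) (b : F) (z z' : L) k :
  z * z' = 1 -> z + z' = 2 * f b -> z ^+ k.*2 = -1 -> root (chebT F k) b.
Proof.
move=> zz' sz zk; rewrite rootE -(fmorph_eq0 f).
have := chebT_Joukowski k zz' sz.
rewrite (expr_inverse_pair k zz') zk mulN1r addNr => /eqP.
by rewrite mulf_eq0 (negPf (two_neq0_extension f)).
Qed.

(** z^q = z gives z^(q-1) = 1, where q - 1 = 2n. *)
Lemma root_chebU_residue (b : F) :
  legendre (b ^+ 2 - 1) = 1 -> root (chebU F n.-1) b.
Proof.
move=> leg; have d0 : b ^+ 2 - 1 != 0.
  by apply/eqP => d0; move: leg; rewrite d0 /legendre eqxx.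
have [L [f [z [z' [zz' sz zNz' _]]]]] := joukowski_preimage d0.
rewrite leg eqxx => zq; apply: (root_chebU zz' sz zNz').
rewrite prednK ?half_card_gt0 //; have z0 : z != 0.
  by apply: contra_eq_neq zz' => ->; rewrite mul0r eq_sym oner_eq0.
by apply: (mulfI z0); rewrite -exprS -card_odd zq mulr1.
Qed.

(** z^q = 1/z gives z^(q+1) = 1, where q + 1 = 2(n + 1). *)
Lemma root_chebU_nonresidue (b : F) :
  legendre (b ^+ 2 - 1) = -1 -> root (chebU F n) b.
Proof.
move=> leg; have d0 : b ^+ 2 - 1 != 0.
  by apply/eqP => d0; move: leg; rewrite d0 /legendre eqxx.
have [L [f [z [z' [zz' sz zNz' _]]]]] := joukowski_preimage d0.
rewrite leg => zq; apply: (root_chebU zz' sz zNz').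
by rewrite doubleS exprS -card_odd zq.
Qed.

(* The identity [(z + 1) ^ 2 = 2 z (b + 1)] for [z + 1 / z = 2 b], raised to the
   power [n], turns the Frobenius action on [z] into the value of [z ^ n]. *)
Lemma joukowski_half_power (b : F) (s : int) : s = 1 \/ s = -1 ->
    b \in Bset 1 s s ->
  exists (L : fieldType) (f : {rmorphism F -> L}) (z z' : L),
    [/\ z * z' = 1, z + z' = 2 * f b, z != z'
      & z ^+ (uphalf n).*2 = f (legendre (2 : F) * s)%:~R].
Proof.
move=> hs; rewrite inE !legendre_eq // => /andP[/eqP bm /eqP bp].
have d0 : b ^+ 2 - 1 != 0.
  apply/eqP => d0; have : ((1 - b) * (1 + b)) ^+ n = 0.
    rewrite -subr_sqr expr1n -opprB d0 oppr0 expr0n.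
    by rewrite -leqn0 leqNgt half_card_gt0.
  rewrite exprMn bm bp -rmorphM.
  by case: hs => ->; apply/eqP; rewrite oner_eq0.
(* Since (1 - b)^n (1 + b)^n = s^2 = 1, the parity of n alone decides whether z^q is z or 1/z. *)
have dn : (b ^+ 2 - 1) ^+ n = (-1) ^+ n.
  rewrite (_ : b ^+ 2 - 1 = -1 * ((1 - b) * (1 + b))); last by ring.
  rewrite !exprMn bm bp -rmorphM.
  by case: hs => ->; rewrite ?mulrNN (mulr1 (1 : int)) mulr1.
have [L [f [z [z' [zz' sz zNz' Frob zq]]]]] := joukowski_preimage d0.
exists L, f, z, z'; split=> //.
have z0 : z != 0.
  by apply: contra_eq_neq zz' => ->; rewrite mul0r eq_sym oner_eq0.
set t := (legendre 2 * s)%:~R : F.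
have tE : (2 * (1 + b)) ^+ n = t
  by rewrite exprMn bp /t rmorphM /= legendre_Euler.
have tt : t * t = 1.
  have st : legendre (2 : F) * s = 1 \/ legendre (2 : F) * s = -1.
    have [->|->] := legendre_neq0 two_neq0; case: hs => ->;
      by [left | right].
  by rewrite /t -rmorphM; case: st => ->.
have z1sq : (z + 1) ^+ 2 = z * f (2 * (1 + b)).
  by rewrite rmorphM rmorph_nat rmorphD rmorph1 mulrDr -sz mulr1; ring: zz'.
have z10 : z + 1 != 0.
  rewrite -sqrf_eq0 z1sq mulf_neq0 // fmorph_eq0 mulf_neq0 ?two_neq0 //.
  apply: contraNneq d0 => b1.
  have -> : b ^+ 2 - 1 = (1 + b) * (b - 1) by ring.
  by rewrite b1 mul0r.
(* Multiply the n-th power of [z1sq] by z + 1 and use (z + 1)^q = z^q + 1. *)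
have key : z ^+ n * f t * (z + 1) = z ^+ #|F| + 1.
  have -> : z ^+ #|F| + 1 = (z + 1) ^+ #|F| by rewrite Frob expr1n.
  rewrite card_odd exprS -mul2n exprM z1sq exprMn -rmorphXn tE.
  by rewrite mulrC.
have zt : z ^+ (uphalf n).*2 * f t = 1.
  apply: (mulIf z10); rewrite mul1r.
  (* For even n, z^q = z and z + 1 cancels; for odd n the additional factor z turns 1/z + 1 into z +
     1. *)
  have -> : (uphalf n).*2 = (odd n + n)%N by lia.
  rewrite exprD -!mulrA [z ^+ n * _]mulrA key zq legendre_eq; last by left.
  rewrite dn -signr_odd; case: (odd n).
    by rewrite eq_sym (negPf one_neqN1) mulrDr zz' mulr1 addrC.
  by rewrite eqxx mul1r.
by rewrite -[LHS]mulr1 -(rmorph1 f) -tt rmorphM mulrA zt mul1r.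
Qed.

(** For s = -nu the half power z^(2m) is nu s = -1; for s = nu, in the next lemma, it is 1. *)
Lemma root_chebT_Bset (b : F) :
  b \in Bset 1 (- legendre (2 : F)) (- legendre (2 : F)) ->
  root (chebT F (uphalf n)) b.
Proof.
have nu := legendre_neq0 two_neq0 => hb.
have [|L [f [z [z' [zz' sz _ zm]]]]] := joukowski_half_power _ hb.
  by case: nu => ->; [right | left].
apply: (root_chebT zz' sz); rewrite zm.
by case: nu => ->; rewrite ?mulNr ?mul1r ?opprK ?rmorphN ?rmorph1.
Qed.

Lemma root_chebU_Bset (b : F) :
  b \in Bset 1 (legendre (2 : F)) (legendre (2 : F)) ->
  root (chebU F (uphalf n).-1) b.
Proof.
have nu := legendre_neq0 two_neq0 => hb.
have [L [f [z [z' [zz' sz zNz' zm]]]]] := joukowski_half_power nu hb.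
apply: (root_chebU zz' sz zNz').
rewrite prednK ?uphalf_gt0 ?half_card_gt0 // zm.
by case: nu => ->; rewrite ?mulrNN mul1r rmorph1.
Qed.

(** * Counting and product formulas *)

(** The two root sets partition F without 1 and -1, and q - 2 is the degree sum (n - 1) + n. The
    cardinalities serve again to count the sets [Bset]. *)
Lemma chebU_legendre :
  [/\ #|[set b : F | legendre (b ^+ 2 - 1) == 1]| = n.-1,
      #|[set b : F | legendre (b ^+ 2 - 1) == -1]| = n,
      chebU F n.-1 = (2 ^+ n.-1)%:P *
        \prod_(b : F | legendre (b ^+ 2 - 1) == 1) ('X - b%:P)
    & chebU F n = (2 ^+ n)%:P *
        \prod_(b : F | legendre (b ^+ 2 - 1) == -1) ('X - b%:P)].
Proof.
set A := [set b | _ == 1]; set B := [set b | _ == -1].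
have [sz1 lc1] := size_lead_chebU n.-1 two_neq0.
have [sz2 lc2] := size_lead_chebU n two_neq0.
have cardAB : (#|A| + #|B| + 2 = #|F|)%N.
  have -> : (#|A| + #|B|)%N = #|A :|: B|.
    rewrite cardsU (_ : A :&: B = set0) ?cards0 ?subn0 //.
    by apply/setP => b; rewrite !inE; apply/andP => -[/eqP->].
  have -> : A :|: B = ~: [set 1; -1].
    apply/setP => b; rewrite !inE.
    rewrite -[(b == 1) || _]sqrf_eq1 -[b ^+ 2 == 1]subr_eq0.
    have [->|/legendre_neq0[]->] := eqVneq (b ^+ 2 - 1) 0 => //.
    by rewrite /legendre eqxx.
  rewrite addnC -[2%N]/(1 + 1)%N.
  by rewrite -(cardsC [set (1 : F); -1]) cards2 one_neqN1.
have [||b|b||] := @prod_complementary_roots F (chebU F n.-1) (chebU F n) A B.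
- by rewrite -size_poly_eq0 sz1.
- by rewrite -size_poly_eq0 sz2.
- by rewrite inE => /eqP/root_chebU_residue.
- by rewrite inE => /eqP/root_chebU_nonresidue.
- by rewrite cardAB sz1 sz2 card_odd; have := half_card_gt0; lia.
rewrite sz1 sz2 lc1 lc2 => -[<-] [<-] eq1 eq2; split=> //.
  by rewrite eq1; congr (_ * _); apply: eq_bigl => b; rewrite inE.
by rewrite eq2; congr (_ * _); apply: eq_bigl => b; rewrite inE.
Qed.

(** The two sets together are one of the sets counted in [chebU_legendre], of size n - 1 for even n
    and n for odd n: in both cases 2m - 1 = m + (m - 1), the degree sum. *)
Lemma cheb_Bset (m := uphalf n) (nu := legendre (2 : F)) :
  chebT F m = (2 ^+ m.-1)%:P * \prod_(b in Bset 1 (- nu) (- nu)) ('X - b%:P) /\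
  chebU F m.-1 = (2 ^+ m.-1)%:P * \prod_(b in Bset 1 nu nu) ('X - b%:P).
Proof.
have [sz1 lc1] := size_lead_chebT m two_neq0.
have [sz2 lc2] := size_lead_chebU m.-1 two_neq0.
have m_gt0 : (0 < m)%N by rewrite uphalf_gt0 half_card_gt0.
set A := Bset _ _ _; set B := Bset _ nu nu.
have cardAB : (#|A| + #|B| = m.*2.-1)%N.
  have -> : (#|A| + #|B|)%N = #|A :|: B|.
    rewrite cardsU (_ : A :&: B = set0) ?cards0 ?subn0 //.
    apply/setP => b; rewrite !inE.
    apply/negP => /andP[/andP[/eqP-> _] /andP[+ _]].
    by rewrite /nu; have [->|->] := legendre_neq0 two_neq0.
  have -> : A :|: B = [set b : F | legendre (b ^+ 2 - 1) == (-1) ^+ n].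
    apply/setP => b; rewrite !inE [RHS]legendre_eq; last first.
      by rewrite -signr_odd; case: (odd n); [right | left].
    have -> : b ^+ 2 - 1 = -1 * ((1 - b) * (1 + b)) by ring.
    rewrite !exprMn -(legendre_Euler (1 - b)) -(legendre_Euler (1 + b)).
    rewrite rmorphXn rmorphN rmorph1 -rmorphM.
    rewrite -[X in _ = (_ == X)]mulr1.
    rewrite [RHS](inj_eq (mulfI _)) ?signr_eq0 //.
    have leg (a : F) : [\/ legendre a = 0, legendre a = 1 | legendre a = -1].
      have [->|/legendre_neq0[]] := eqVneq a 0; last 2 first.
      - by constructor 2.
      - by constructor 3.
      by constructor 1; rewrite /legendre eqxx.
    (* Both sides say that 1 - b and 1 + b have the same nonzero symbol. *)
    by rewrite /nu; have [->|->] := legendre_neq0 two_neq0;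
      case: (leg (1 - b)) => ->; case: (leg (1 + b)) => -> /=;
      rewrite ?mul0r ?mulr0 ?mul1r ?mulr1 ?mulrNN ?mulr1;
      rewrite ?rmorphN ?rmorph1 ?rmorph0 ?eqxx;
      rewrite ?[0 == 1]eq_sym ?[- 1 == 1]eq_sym ?oner_eq0 ?(negPf one_neqN1).
  have [cA cB _ _] := chebU_legendre.
  rewrite -signr_odd; have := odd_double_half n.
  by case: (odd n); rewrite /= ?expr1 ?expr0 ?cA ?cB /m; lia.
have [||b|b||_ _] := @prod_complementary_roots F (chebT F m) (chebU F m.-1) A B.
- by rewrite -size_poly_eq0 sz1.
- by rewrite -size_poly_eq0 sz2.
- exact: root_chebT_Bset.
- exact: root_chebU_Bset.
- by rewrite cardAB sz1 sz2; lia.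
by rewrite lc1 lc2.
Qed.

End OddFiniteField.

(** * The indices in terms of q *)

Theorem theorem9p3 (F : finFieldType) (hodd : odd #|F|) :
  let q := #|F| in
  let eps := legendre (-1 : F) in
  let nu := legendre (2 : F) in
  let m := `|((q%:Z - eps) %/ 4)%Z|%N in
  [/\ chebT F m = (2 ^+ m.-1)%:P * \prod_(b in Bset 1 (- nu) (- nu)) ('X - b%:P),
      chebU F m.-1 = (2 ^+ m.-1)%:P * \prod_(b in Bset 1 nu nu) ('X - b%:P),
      chebU F ((q - 3) %/ 2)%N =
        (2 ^+ ((q - 3) %/ 2)%N)%:P *
          \prod_(b : F | legendre (b ^+ 2 - 1) == 1) ('X - b%:P)
    & chebU F ((q - 1) %/ 2)%N =
        (2 ^+ ((q - 1) %/ 2)%N)%:P *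
          \prod_(b : F | legendre (b ^+ 2 - 1) == -1) ('X - b%:P)].
Proof.
move=> q eps nu m.
have q_n : q = (#|F|./2).*2.+1 := card_odd hodd.
have n_gt0 := half_card_gt0 hodd.
have epsE : eps = (-1) ^+ odd #|F|./2.
  apply/eqP; rewrite legendre_eq //; last by case: (odd _); [right | left].
  by rewrite rmorph_sign signr_odd.
(* With n = (q - 1)/2, q - eps is 2n for even n and 2n + 2 for odd n. *)
have -> : m = uphalf #|F|./2.
  rewrite /m epsE q_n.
  by case: (boolP (odd _)) => /= ?; rewrite ?expr1 ?expr0; lia.
(* Here q >= 3 because n > 0, so the truncated subtraction is exact. *)
have -> : ((q - 3) %/ 2 = #|F|./2.-1)%N by lia.
have -> : ((q - 1) %/ 2 = #|F|./2)%N by lia.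
have [T_m U_m] := cheb_Bset hodd.
have [_ _ U_res U_nonres] := chebU_legendre hodd.
by split.
Qed.
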